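(* Let $R$ be an associative ring with identity. If $R$ is right $F$-injective, then $R$ is semilocal if and only if $R$ is right finite dimensional.
   Context: For a module $M$, the Goldie dimension $\mathrm{G.dim}\, M$ equals $n$ if $M$ has an essential submodule that is a direct sum of $n$ uniform submodules; if no such integer $n$ exists, $\mathrm{G.dim}\, M=+\infty$. (A nonzero module is uniform if every nonzero submodule of it is essential.) A ring $R$ is right finite dimensional if $\mathrm{G.dim}(R_R)<+\infty$. A ring $R$ is right $F$-injective if every right $R$-homomorphism from a finitely generated right ideal of $R$ to $R_R$ extends to a right $R$-homomorphism $R_R\to R_R$. A ring $R$ is semilocal if $R/J(R)$ is semisimple artinian, where $J(R)$ is the Jacobson radical. *)

(* Defs.v *)
From HB Require Import structures.
From mathcomp Require Import all_boot all_order all_algebra.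
From mathcomp Require Import boolp classical_sets.

Set Implicit Arguments.
Unset Strict Implicit.
Unset Printing Implicit Defensive.
Import GRing.Theory.

Local Open Scope classical_set_scope.
Local Open Scope ring_scope.

(* Rings are of type [pzRingType]: associative with identity, not necessarily
   commutative, the zero ring being allowed.  A right module over [R] is a left
   module over the converse ring [R^c]. *)

Section Modules.
Variables (S : pzRingType) (M : lmodType S).
Implicit Types (N L K U : set M) (x y : M).

Definition submodule N : Prop := GRing.submod_closed (in_set N).

Lemma submoduleP N :
  submodule N <-> N 0 /\ forall (a : S) x y, N x -> N y -> N (a *: x + y).
Proof.
split=> [[N0 Nlin]|[N0 Nlin]].
  split=> [|a x y Nx Ny]; first exact/set_mem/N0.
  by apply/set_mem/Nlin; apply: mem_set.
split=> [|a x y /set_mem Nx /set_mem Ny]; first exact/mem_set.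
exact/mem_set/Nlin.
Qed.

Definition finitely_generated N : Prop :=
  exists n (g : 'I_n -> M),
    N = [set x | exists c : 'I_n -> S, x = \sum_(i < n) c i *: g i].

Definition essential_in N K : Prop :=
  [/\ submodule N, N `<=` K &
      forall L, submodule L -> L `<=` K -> L <> [set 0] -> N `&` L <> [set 0]].

Definition uniform U : Prop :=
  [/\ submodule U, U <> [set 0] &
      forall N, submodule N -> N `<=` U -> N <> [set 0] -> essential_in N U].

Definition sum_submodules n (U : 'I_n -> set M) : set M :=
  [set x | exists2 u : 'I_n -> M, (forall i, U i (u i)) & x = \sum_(i < n) u i].

Definition independent n (U : 'I_n -> set M) : Prop :=
  forall u : 'I_n -> M,
    (forall i, U i (u i)) -> \sum_(i < n) u i = 0 -> forall i, u i = 0.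

(* [Gdim_eq n] is "G.dim M = n"; the dimension is finite when such an [n]
   exists. *)
Definition Gdim_eq (n : nat) : Prop :=
  exists U : 'I_n -> set M,
    [/\ forall i, uniform (U i), independent U &
        essential_in (sum_submodules U) setT].

Definition Gdim_finite : Prop := exists n, Gdim_eq n.

Definition maximal_submodule N : Prop :=
  [/\ submodule N, N <> setT &
      forall L, submodule L -> N `<=` L -> L = N \/ L = setT].

Definition simple_submodule N : Prop :=
  [/\ submodule N, N <> [set 0] &
      forall L, submodule L -> L `<=` N -> L = [set 0] \/ L = N].

(* The module is the sum of its simple submodules. *)
Definition semisimple_module : Prop :=
  forall x, exists n (y : 'I_n -> M),
    (forall i, exists2 N, simple_submodule N & N (y i)) /\
    x = \sum_(i < n) y i.

Definition artinian_module : Prop :=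
  forall N : nat -> set M,
    (forall k, submodule (N k)) -> (forall k, N k.+1 `<=` N k) ->
    exists k, forall l, (k <= l)%N -> N l = N k.

(* [f] restricts to a homomorphism from the submodule [N] to [M]; its values
   outside [N] are irrelevant. *)
Definition hom_on N (f : M -> M) : Prop :=
  forall (a : S) x y, N x -> N y -> f (a *: x + y) = a *: f x + f y.

End Modules.

Arguments Gdim_eq {S} M n.
Arguments Gdim_finite {S} M.
Arguments semisimple_module {S} M.
Arguments artinian_module {S} M.

(* R_R: the scalar [a : R^c] sends [x] to the product [x * a] of [R]. *)
Definition right_regular (R : pzRingType) : lmodType R^c := (R^c)^o.

Lemma right_regular_scaleE (R : pzRingType) (a : R^c) (x : right_regular R) :
  a *: x = (x : R) * (a : R) :> R.
Proof. by []. Qed.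

Definition right_finite_dimensional (R : pzRingType) : Prop :=
  Gdim_finite (right_regular R).

Definition right_F_injective (R : pzRingType) : Prop :=
  forall (I : set (right_regular R)) (f : right_regular R -> right_regular R),
    submodule I -> finitely_generated I -> hom_on I f ->
    exists g : {linear right_regular R -> right_regular R},
      forall x, I x -> g x = f x.

Definition jacobson (R : pzRingType) : set R :=
  [set x | forall N : set (right_regular R), maximal_submodule N -> N x].

Section JacobsonIdeal.
Variable R : pzRingType.
Implicit Types x y r : R.

Definition jacobson_pred : {pred R} := in_set (@jacobson R).

Lemma jacobson_predP x : reflect (jacobson x) (x \in jacobson_pred).
Proof. exact: asboolP. Qed.

Lemma jacobson_zmod_closed : zmod_closed jacobson_pred.
Proof.
split=> [|x y /jacobson_predP Jx /jacobson_predP Jy]; apply/jacobson_predP.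
  by move=> N [/submoduleP[N0 _] _ _].
move=> N maxN; have [/submoduleP[_ Nlin] _ _] := maxN.
have := Nlin (-1 : R^c) y x (Jy N maxN) (Jx N maxN).
by rewrite right_regular_scaleE mulrN1 addrC.
Qed.

HB.instance Definition _ :=
  GRing.isZmodClosed.Build R jacobson_pred jacobson_zmod_closed.

Lemma jacobsonMr r x : x \in jacobson_pred -> x * r \in jacobson_pred.
Proof.
move=> /jacobson_predP Jx; apply/jacobson_predP => N maxN.
have [/submoduleP[N0 Nlin] _ _] := maxN.
by have := Nlin (r : R^c) x 0 (Jx N maxN) N0; rewrite addr0.
Qed.

Lemma jacobsonMl r x : x \in jacobson_pred -> r * x \in jacobson_pred.
Proof.
move=> /jacobson_predP Jx; apply/jacobson_predP => N maxN.
have [/submoduleP[N0 Nlin] NnT Nmax] := maxN.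
pose L : set (right_regular R) := [set y | N (r * (y : R))].
have [LT|LnT] := pselect (L = setT).
  by have : L x by rewrite LT.
have subL : submodule L.
  apply/submoduleP; split=> [|a y z Ly Lz]; rewrite /L /=; first by rewrite mulr0.
  by rewrite right_regular_scaleE mulrDr mulrA; apply: Nlin.
apply: (Jx L); split=> // K /submoduleP[K0 Klin] LK.
have [[k Kk Nrk]|KL] := pselect (exists2 k, K k & ~ N (r * (k : R))); last first.
  left; apply/seteqP; split=> // k Kk.
  by apply: contrapT => Nrk; apply: KL; exists k.
right.
pose P : set (right_regular R) :=
  [set z | exists2 m, N m & exists s, z = m + r * (k : R) * s :> R].
have subP : submodule P.
  apply/submoduleP; split; first by exists 0 => //; exists 0; rewrite mulr0 addr0.
  move=> a _ _ [m Nm [s ->]] [m' Nm' [s' ->]].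
  exists ((a : R^c) *: m + m'); first exact: Nlin.
  exists (s * (a : R) + s'); rewrite !right_regular_scaleE.
  by rewrite mulrDl mulrDr !mulrA addrACA.
have NP : N `<=` P by move=> m Nm; exists m => //; exists 0; rewrite mulr0 addr0.
have [PN|PT] := Nmax P subP NP.
  by case: Nrk; rewrite -PN; exists 0 => //; exists 1; rewrite mulr1 add0r.
have [m Nm [s rE]] : P r by rewrite PT.
have K1 : K (1 : R).
  have L1 : L (1 - (k : R) * s).
    by rewrite /L /= mulrBr mulr1 mulrA [X in X - _]rE addrK.
  by have := Klin (s : R^c) k _ Kk (LK _ L1); rewrite right_regular_scaleE subrKC.
apply/seteqP; split=> // z _.
by have := Klin (z : R^c) _ _ K1 K0; rewrite right_regular_scaleE mul1r addr0.
Qed.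

End JacobsonIdeal.

(* The ring R/J(R).  The library quotients noncommutative rings only as additive
   groups, so the multiplication is supplied here. *)
Definition quotJ (R : pzRingType) : Type := Quotient.quot (@jacobson_pred R).

Section QuotientRing.
Local Open Scope quotient_scope.
Variable R : pzRingType.
Local Notation Q := (quotJ R).

HB.instance Definition _ := GRing.Zmodule.on Q.
HB.instance Definition _ := EqQuotient.on Q.
HB.instance Definition _ := ZmodQuotient.on Q.

Definition quotJ_one : Q := \pi_Q 1.
Definition quotJ_mul (x y : Q) : Q := \pi_Q (repr x * repr y).

Lemma quotJ_eqE (x y : R) :
  (\pi_Q x == \pi_Q y) = (x - y \in @jacobson_pred R).
Proof. by rewrite [RHS]Quotient.idealrBE. Qed.

Lemma quotJ_pi_mul : {morph \pi_Q : x y / x * y >-> quotJ_mul x y}.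
Proof.
move=> x y; apply/eqP; rewrite quotJ_eqE.
set x' := repr _; set y' := repr _.
have Jx : x - x' \in @jacobson_pred R by rewrite -quotJ_eqE reprK.
have Jy : y - y' \in @jacobson_pred R by rewrite -quotJ_eqE reprK.
have -> : x * y - x' * y' = (x - x') * y + x' * (y - y').
  by rewrite mulrBl mulrBr addrA subrK.
by apply: rpredD; [apply: jacobsonMr | apply: jacobsonMl].
Qed.

Let mulE (x y : R) : quotJ_mul (\pi_Q x) (\pi_Q y) = \pi_Q (x * y).
Proof. exact/esym/quotJ_pi_mul. Qed.

Let piD (x y : R) : \pi_Q x + \pi_Q y = \pi_Q (x + y) :> Q.
Proof. exact/esym/pi_addr. Qed.

Let mulA : associative quotJ_mul.
Proof.
move=> x y z; rewrite -[x]reprK -[y]reprK -[z]reprK.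
by rewrite (mulE (repr y)) (mulE (repr x) (repr y)) !mulE mulrA.
Qed.

Let mul1q : left_id quotJ_one quotJ_mul.
Proof. by move=> x; rewrite -[x]reprK mulE mul1r. Qed.

Let mulq1 : right_id quotJ_one quotJ_mul.
Proof. by move=> x; rewrite -[x]reprK mulE mulr1. Qed.

Let mulDl : left_distributive quotJ_mul +%R.
Proof.
move=> x y z; rewrite -[x]reprK -[y]reprK -[z]reprK.
by rewrite (piD (repr x)) !mulE piD mulrDl.
Qed.

Let mulDr : right_distributive quotJ_mul +%R.
Proof.
move=> x y z; rewrite -[x]reprK -[y]reprK -[z]reprK.
by rewrite (piD (repr y)) !mulE piD mulrDr.
Qed.

HB.instance Definition _ :=
  GRing.Zmodule_isPzRing.Build Q mulA mul1q mulq1 mulDl mulDr.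

Definition quotJ_pi (x : R) : Q := \pi_Q x.

Lemma quotJ_pi_is_zmod_morphism : zmod_morphism quotJ_pi.
Proof.
move=> x y; rewrite /quotJ_pi; set z := - y.
by rewrite -piD (@pi_oppr _ _ _ _ _ Q y).
Qed.

Lemma quotJ_pi_is_monoid_morphism : monoid_morphism quotJ_pi.
Proof. by split=> [|x y] //; apply: quotJ_pi_mul. Qed.

HB.instance Definition _ :=
  GRing.isZmodMorphism.Build R Q quotJ_pi quotJ_pi_is_zmod_morphism.
HB.instance Definition _ :=
  GRing.isMonoidMorphism.Build R Q quotJ_pi quotJ_pi_is_monoid_morphism.

Lemma quotJ_pi_surj (q : Q) : exists x, q = quotJ_pi x.
Proof. by exists (repr q); rewrite /quotJ_pi reprK. Qed.

Lemma quotJ_pi_eq0 (x : R) : quotJ_pi x = 0 <-> jacobson x.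
Proof.
rewrite -(rmorph0 quotJ_pi); split=> [/eqP|Jx]; last apply/eqP.
  by rewrite quotJ_eqE subr0 => /jacobson_predP.
by rewrite quotJ_eqE subr0; apply/jacobson_predP.
Qed.

End QuotientRing.

Definition semisimple_artinian (R : pzRingType) : Prop :=
  semisimple_module (right_regular R) /\ artinian_module (right_regular R).

Definition semilocal (R : pzRingType) : Prop := semisimple_artinian (quotJ R).

(* Main.v *)
(* Both directions rest on one construction.  Given elements [e i] that are 1 modulo
   [P i] and 0 modulo [P j] for [j > i], where the [P i] are proper one-sided ideals,
   put [a 0 = 1] and [a (i+1) = a i - a i * e i * a i].  Then [a i] lies in [P j]
   for [j < i] and is 1 modulo [P j] for [j >= i], while the right annihilators of
   the [a i] increase.

   If [R] has finite right Goldie dimension [n], take for the [P i] maximal right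
   ideals.  A nonunit [c] has a nonzero right annihilator, by injectivity and
   finiteness of the dimension; applied to [c = 1 - a i * e i] this makes the
   annihilators grow by a new independent summand at each step, so there are at most
   [n] such ideals (the argument is that of Camps and Dicks).  Hence [J(R)] is a finite
   intersection of maximal right ideals.

   Conversely, if the right ideals [x j R] are independent, injectivity extends the
   projections of their sum, so the left annihilators of the [x j] are comaximal, and
   their images [P j] in [R/J] are proper.  The annihilators of the [a i] then form a
   strict chain in [R/J], so the number of the [x j] is at most its length. *)

Require Import Defs.
From mathcomp Require Import all_boot all_order all_algebra.
From mathcomp Require Import boolp classical_sets.

Set Implicit Arguments.
Unset Strict Implicit.
Unset Printing Implicit Defensive.
Import GRing.Theory.

Local Open Scope classical_set_scope.
Local Open Scope ring_scope.

(** * Independent elements and Goldie dimension *)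

Section Submodules.
Variables (S : pzRingType) (M : lmodType S).
Implicit Types (N L K U V : set M) (x y z : M).

Lemma submod0 N : submodule N -> N 0.
Proof. by case/submoduleP. Qed.

Lemma submodZ N a x : submodule N -> N x -> N (a *: x).
Proof. by case/submoduleP=> N0 Nlin Nx; rewrite -[_ *: _]addr0; apply: Nlin. Qed.

Lemma submodD N x y : submodule N -> N x -> N y -> N (x + y).
Proof. by case/submoduleP=> _ Nlin Nx Ny; rewrite -[x]scale1r; apply: Nlin. Qed.

Lemma submodN N x : submodule N -> N x -> N (- x).
Proof. by move=> sN Nx; rewrite -scaleN1r; apply: submodZ. Qed.

Lemma submodB N x y : submodule N -> N x -> N y -> N (x - y).
Proof. by move=> sN Nx Ny; apply: submodD => //; apply: submodN. Qed.

Lemma submodI N L : submodule N -> submodule L -> submodule (N `&` L).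
Proof.
move=> sN sL; apply/submoduleP; split=> [|a x y [Nx Lx] [Ny Ly]].
  by split; apply: submod0.
by split; (apply: submodD; [|apply: submodZ|]).
Qed.

Lemma submod_sum N (I : finType) (P : pred I) (u : I -> M) :
  submodule N -> (forall i, P i -> N (u i)) -> N (\sum_(i | P i) u i).
Proof.
move=> sN Nu; apply: big_ind => //; first exact: submod0.
by move=> x y; apply: submodD.
Qed.

Lemma submod_neq0 N : submodule N -> N <> [set 0] -> exists2 x, N x & x <> 0.
Proof.
move=> sN Nn0; apply: contrapT => noN; apply: Nn0; apply/seteqP; split=> [x Nx|x ->].
  by apply: contrapT => xn0; apply: noN; exists x.
exact: submod0.
Qed.

Lemma set_neq0 N x : N x -> x <> 0 -> N <> [set 0].
Proof. by move=> Nx xn0 N0; apply: xn0; move: Nx; rewrite N0. Qed.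

Definition cyclic_submod x : set M := [set y | exists a : S, y = a *: x].

Lemma cyclic_submodP x : submodule (cyclic_submod x).
Proof.
apply/submoduleP; split=> [|a _ _ [b ->] [c ->]]; first by exists 0; rewrite scale0r.
by exists (a * b + c); rewrite scalerA scalerDl.
Qed.

Lemma cyclic_submod_id x : cyclic_submod x x.
Proof. by exists 1; rewrite scale1r. Qed.

Lemma uniform_multiple U x y : uniform U -> U x -> U y -> x <> 0 -> y <> 0 ->
  exists a b : S, a *: x = b *: y /\ a *: x <> 0.
Proof.
move=> [sU _ unifU] Ux Uy xn0 yn0.
have subU z : U z -> cyclic_submod z `<=` U by move=> Uz _ [a ->]; apply: submodZ.
have [_ _ ess] := unifU _ (cyclic_submodP x) (subU _ Ux)
  (set_neq0 (cyclic_submod_id x) xn0).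
have := ess _ (cyclic_submodP y) (subU _ Uy) (set_neq0 (cyclic_submod_id y) yn0).
case/submod_neq0 => [|z [[a za] [b zb]] zn0].
  by apply: submodI; apply: cyclic_submodP.
by exists a, b; rewrite -za -zb.
Qed.

(** The sum of the nonzero cyclic submodules generated by the [x i] is direct. The conclusion is
    [c i *: x i = 0] and not [c i = 0], since the [x i] may have torsion. *)
Definition indep_elts (I : finType) (x : I -> M) : Prop :=
  (forall i, x i <> 0) /\
  forall c : I -> S, \sum_i c i *: x i = 0 -> forall i, c i *: x i = 0.

Definition span_elts (I : finType) (P : pred I) (x : I -> M) : set M :=
  [set y | exists c : I -> S, y = \sum_(i | P i) c i *: x i].

Lemma span_eltsP (I : finType) (P : pred I) (x : I -> M) :
  submodule (span_elts P x).
Proof.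
apply/submoduleP; split=> [|a _ _ [b ->] [c ->]].
  by exists (fun=> 0); rewrite big1 // => i _; rewrite scale0r.
exists (fun i => a * b i + c i); rewrite scaler_sumr -big_split /=.
by apply: eq_bigr => i _; rewrite scalerDl scalerA.
Qed.

Lemma indep_elts_bij (I J : finType) (h : J -> I) (x : I -> M) :
  bijective h -> indep_elts x -> indep_elts (x \o h).
Proof.
move=> bijh [xn0 indx]; split=> [j|c sum0 j]; first exact: xn0.
have [h' hK h'K] := bijh.
have := indx (c \o h') _ (h j); rewrite /= hK; apply.
rewrite -[RHS]sum0 (reindex h) /=; last by exists h' => i _.
by apply: eq_bigr => i _; rewrite hK.
Qed.

Lemma indep_elts_replace (I : finType) (x : I -> M) i z :
  indep_elts x -> z <> 0 ->
  (forall a, span_elts (predC1 i) x (a *: z) -> a *: z = 0) ->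
  indep_elts (fun j => if j == i then z else x j).
Proof.
move=> [xn0 indx] zn0 disj; split=> [j|c]; first by case: eqP.
have sumE : \sum_(j | j != i) c j *: (if j == i then z else x j)
    = \sum_(j | j != i) c j *: x j.
  by apply: eq_bigr => j /negPf ->.
rewrite (bigD1 i) //= eqxx sumE => /eqP; rewrite addr_eq0 => /eqP zE.
have z0 : c i *: z = 0.
  apply: disj; exists (fun j => - c j).
  by rewrite zE -sumrN; apply: eq_bigr => j _; rewrite scaleNr.
have := indx (fun j => if j == i then 0 else c j).
rewrite (bigD1 i) //= eqxx scale0r add0r => indx'.
move=> j; case: eqP => [->|/eqP/negPf ji] //.
have := indx' _ j; rewrite ji; apply.
transitivity (\sum_(j | j != i) c j *: x j); first by apply: eq_bigr => l /negPf ->.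
by apply: oppr_inj; rewrite -zE z0 oppr0.
Qed.

Lemma indep_elts_add (I : finType) (x : I -> M) z :
  indep_elts x -> z <> 0 ->
  (forall a, span_elts xpredT x (a *: z) -> a *: z = 0) ->
  indep_elts (oapp x z).
Proof.
move=> [xn0 indx] zn0 disj; split=> [[j|]|c] //=.
rewrite (bigD1 None) //= (reindex_omap Some id) => [|[]//] /=.
under eq_bigl do rewrite eqxx.
move=> /eqP; rewrite addr_eq0 => /eqP zE.
have z0 : c None *: z = 0.
  apply: disj; exists (fun j => - c (Some j)).
  by rewrite zE -sumrN; apply: eq_bigr => j _; rewrite scaleNr.
case=> [j|//]; apply: (indx (c \o Some)) => /=.
by apply: oppr_inj; rewrite -zE z0 oppr0.
Qed.

(* If [V] met every [U j], then, multiplying a nonzero element of the sum of the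
   [U j] successively by scalars pushing its components into [V], one would see
   that [V] is essential. *)
Lemma nonessential_disjoint n (U : 'I_n -> set M) V y :
  (forall i, uniform (U i)) -> independent U ->
  essential_in (sum_submodules U) setT ->
  submodule V -> y <> 0 -> (forall a, V (a *: y) -> a *: y = 0) ->
  exists j, V `&` U j = [set 0].
Proof.
move=> unifU indU [sumU _ essU] sV yn0 Vy0; apply: contrapT => noj.
have VU j : exists2 v, V v /\ U j v & v <> 0.
  have [sU _ _] := unifU j.
  apply: submod_neq0 => [|VUj0]; last by apply: noj; exists j.
  exact: submodI.
have [u [Uu [b usum] un0]] : exists u : 'I_n -> M, [/\ forall i, U i (u i),
    exists b, b *: y = \sum_i u i & \sum_i u i <> 0].
  have := essU _ (cyclic_submodP y) (fun _ _ => I)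
    (set_neq0 (cyclic_submod_id y) yn0).
  case/submod_neq0 => [|z [[u Uu ->] [b zb]] zn0].
    exact/submodI/cyclic_submodP.
  by exists u; split=> //; exists b.
have [m] := ubnP #|[set i | ~~ `[<V (u i)>]]%SET|.
elim: m => // m IHm in u b Uu usum un0 *; rewrite ltnS => lem.
have [Vu|/existsNP[j nVuj]] := pselect (forall i, V (u i)).
  by apply: un0; rewrite -usum; apply: Vy0; rewrite usum; apply: submod_sum.
have ujn0 : u j <> 0 by move=> uj0; apply: nVuj; rewrite uj0; apply: submod0.
have [v [Vv Ujv] vn0] := VU j.
have [a [a' [aE an0]]] := uniform_multiple (unifU j) (Uu j) Ujv ujn0 vn0.
apply: (IHm (fun i => a *: u i) (a * b)).
- by move=> i; apply: submodZ => //; case: (unifU i).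
- by rewrite -scalerA usum scaler_sumr.
- move=> sum0; apply: an0; apply: (indU (fun i => a *: u i)) => // i.
  by apply: submodZ => //; case: (unifU i).
- apply: leq_trans lem; apply: proper_card; apply/properP; split.
    apply/fintype.subsetP => i; rewrite !inE; apply: contra => /asboolP Vui.
    by apply/asboolP; apply: submodZ.
  exists j; rewrite !inE; first exact/asboolP.
  by rewrite negbK; apply/asboolP; rewrite aE; apply: submodZ.
Qed.

(** A Steinitz exchange. The span of the other members misses the multiples of [x' i], so it meets
    some [U j] trivially, and [x' i] can be traded for a nonzero element of [U j]. Once all members
    are traded, two of them in the same uniform submodule would share a nonzero multiple, so [f] is
    injective. *)
Lemma Gdim_bound n (I : finType) (x : I -> M) :
  Gdim_eq M n -> indep_elts x -> (#|I| <= n)%N.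
Proof.
move=> [U [unifU indU essU]] indx.
suff exch (s : seq I) : exists (x' : I -> M) (f : I -> 'I_n),
    indep_elts x' /\ forall i, i \in s -> U (f i) (x' i).
  have [x' [f [[x'n0 indx'] Ux']]] := exch (enum I).
  rewrite -[n in (_ <= n)%N]card_ord; apply: (@leq_card _ _ f) => i j fij.
  apply/eqP; apply: contrapT => /negP nij.
  have Ui : U (f i) (x' i) by apply: Ux'; rewrite mem_enum.
  have Uj : U (f i) (x' j) by rewrite fij; apply: Ux'; rewrite mem_enum.
  have [a [b [aE an0]]] := uniform_multiple (unifU _) Ui Uj (x'n0 i) (x'n0 j).
  have := indx' (fun k => if k == i then a else if k == j then - b else 0) _ i.
  rewrite eqxx; apply: (contra_not _ an0); apply.
  have nji : (j == i) = false by rewrite eq_sym; apply: negbTE.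
  rewrite (bigD1 i) //= eqxx (bigD1 j) /=; last by rewrite nji.
  rewrite nji eqxx.
  rewrite big1 => [|k /andP[/negPf -> /negPf ->]]; last by rewrite scale0r.
  by rewrite addr0 scaleNr aE subrr.
  elim: s => [|i s [x' [f [indx' Ux']]]].
    (* With nothing exchanged yet, only some function [f] is needed. If [I] is inhabited, an index
       in ['I_n] is obtained by taking the zero submodule for [V]. *)
    have [[i]|noi] := pselect (inhabited I); last first.
      by exists x, (fun i => False_rect _ (noi (inhabits i))).
    have [|j _] := nonessential_disjoint unifU indU essU
      (span_eltsP pred0 x) (proj1 indx i).
      by move=> a [c]; rewrite big_pred0_eq.
    by exists x, (fun=> j).
  have [|j Uj0] := nonessential_disjoint unifU indU essU
    (span_eltsP (predC1 i) x') (proj1 indx' i).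
    move=> a [c aE]; have := proj2 indx' (fun k => if k == i then a else - c k) _ i.
    rewrite eqxx; apply; rewrite (bigD1 i) //= eqxx aE -big_split big1 //= => k /negPf ->.
    by rewrite scaleNr subrr.
  have [sUj Ujn0 _] := unifU j; have [u Uju un0] := submod_neq0 sUj Ujn0.
  exists (fun k => if k == i then u else x' k), (fun k => if k == i then j else f k).
  split=> [|k].
    apply: indep_elts_replace => // a Vau.
    have : (span_elts (predC1 i) x' `&` U j) (a *: u) by split=> //; apply: submodZ.
    by rewrite Uj0.
  by rewrite inE; case: eqP => //= _; apply: Ux'.
Qed.

(* A family of maximal size: splitting a member [x i] in two would enlarge it, so
   every [x i] generates a uniform submodule, and adjoining an element would too,
   so the sum of these submodules is essential. *)
Lemma Gdim_finite_of_bound n :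
  (forall k (x : 'I_k -> M), indep_elts x -> (k <= n)%N) -> Gdim_finite M.
Proof.
move=> bound.
pose P k := `[<exists x : 'I_k -> M, indep_elts x>].
have P0 : exists k, P k.
  by exists 0; apply/asboolP; exists (fun=> 0); split=> [[]|c _ []].
have Pn k : P k -> (k <= n)%N by case/asboolP=> x; apply: bound.
have [m /asboolP[x indx] max_m] := ex_maxnP P0 Pn.
have no_option (y : option 'I_m -> M) : ~ indep_elts y.
  move=> indy; suff : P m.+1 by move/max_m; rewrite ltnn.
  have card : #|{: option 'I_m}| = m.+1 by rewrite card_option card_ord.
  apply/asboolP; rewrite -card; exists (y \o enum_val).
  exact/indep_elts_bij/indy/enum_val_bij.
have no_split i y z : cyclic_submod (x i) y -> cyclic_submod (x i) z ->
    y <> 0 -> z <> 0 -> exists a b : S, a *: y = b *: z /\ a *: y <> 0.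
  move=> [b yE] [b' zE] yn0 zn0; apply: contrapT => disj.
  apply: (no_option (oapp (fun j => if j == i then z else x j) y)).
  have key a c : a *: y = \sum_j c j *: (if j == i then z else x j) -> a *: y = 0.
    rewrite (bigD1 i) //= eqxx => aE.
    (* As [y] and [z] are multiples of [x i], this is a relation among the [x j] with coefficient
       [a * b - c i * b'] at [i]; independence kills that term. *)
    have yz : a *: y = c i *: z.
      have := proj2 indx (fun j => if j == i then a * b - c i * b' else - c j) _ i.
      rewrite eqxx scalerBl -!scalerA -yE -zE => h; apply/eqP; rewrite -subr_eq0; apply/eqP.
      apply: h; rewrite (bigD1 i) //= eqxx scalerBl -!scalerA -yE -zE aE.
      rewrite [c i *: z + _]addrC addrK -big_split big1 //= => j /negPf ->.
      by rewrite scaleNr subrr.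
    by apply: contrapT => an0; apply: disj; exists a, (c i).
  apply: indep_elts_add => //; last by move=> a [c aE]; apply: key aE.
  apply: indep_elts_replace => // a [c]; rewrite zE scalerA => aE.
  have := proj2 indx (fun k => if k == i then a * b' else - c k) _ i.
  rewrite eqxx; apply; rewrite (bigD1 i) //= eqxx aE -big_split big1 //= => k /negPf ->.
  by rewrite scaleNr subrr.
exists m, (fun i => cyclic_submod (x i)); split.
- move=> i; split; first exact: cyclic_submodP.
    exact: set_neq0 (cyclic_submod_id _) (proj1 indx i).
  move=> N sN subN Nn0; split=> // L sL subL Ln0.
  have [y Ny yn0] := submod_neq0 sN Nn0; have [z Lz zn0] := submod_neq0 sL Ln0.
  have [a [b [aE an0]]] := no_split i y z (subN _ Ny) (subL _ Lz) yn0 zn0.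
  by apply: (@set_neq0 _ (a *: y)) => //; split; [|rewrite aE]; apply: submodZ.
- move=> u /choice[c uE] sum0 i; rewrite uE; apply: (proj2 indx).
  by rewrite -[RHS]sum0; apply: eq_bigr => j _; rewrite uE.
have sumE : sum_submodules (fun i => cyclic_submod (x i)) = span_elts xpredT x.
  apply/seteqP; split=> [_ [u /choice[c uE] ->]|_ [c ->]].
    by exists c; apply: eq_bigr.
  by exists (fun i => c i *: x i) => // i; exists (c i).
rewrite sumE; split=> [|//|L sL _ Ln0 disj]; first exact: span_eltsP.
have [z Lz zn0] := submod_neq0 sL Ln0; apply: (no_option (oapp x z)).
apply: indep_elts_add => // a az.
have : (span_elts xpredT x `&` L) (a *: z) by split=> //; apply: submodZ.
by rewrite disj.
Qed.

(** In a relation, every term before the last lies in the last [K i], which meets the multiples of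
    the last [z i] trivially; so the last term vanishes, and induction handles the rest. *)
Lemma chain_indep n (K : nat -> set M) (z : nat -> M) :
  (forall i, (i <= n)%N -> submodule (K i)) ->
  (forall i, (i < n)%N -> K i `<=` K i.+1) ->
  (forall i, (i < n)%N -> K i.+1 (z i) /\ z i <> 0) ->
  (forall i a, (i < n)%N -> K i (a *: z i) -> a *: z i = 0) ->
  indep_elts (fun i : 'I_n => z i).
Proof.
move=> sK incK Kz Kz0; split=> [i|c]; first exact: (Kz i _).2.
elim: n => [|n IHn] in sK incK Kz Kz0 c *; first by move=> _ [].
rewrite big_ord_recr /= => sum0.
have Ksum m : (m <= n)%N -> forall j : 'I_n, (j < m)%N -> K m (z j).
  elim: m => [//|m IHm] lem j; rewrite ltnS leq_eqVlt => /predU1P[->|ltjm].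
    by apply: (Kz m _).1; apply: ltnW.
  by apply: incK; [apply: ltnW | apply: IHm => //; apply: ltnW].
have last0 : c ord_max *: z n = 0.
  apply: Kz0 => //; move/eqP: sum0; rewrite addrC addr_eq0 => /eqP ->.
  apply: submodN; first exact: sK.
  by apply: submod_sum => [|i _]; [|apply: submodZ; [|apply: Ksum]] => //; apply: sK.
move=> i; have [ltin|] := ltnP i n; last first.
  move=> lein; suff -> : i = ord_max by [].
  by apply/val_inj/eqP; rewrite /= eqn_leq lein -ltnS ltn_ord.
have := IHn _ _ _ _ (fun j => c (widen_ord (leqnSn n) j)) _ (Ordinal ltin).
have -> : widen_ord (leqnSn n) (Ordinal ltin) = i by apply: val_inj.
apply; last by rewrite -[RHS]sum0 last0 addr0.
- by move=> j lej; apply: sK; apply: leqW.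
- by move=> j lej; apply: incK; apply: leqW.
- by move=> j lej; apply: Kz; apply: leqW.
- by move=> j a lej; apply: Kz0; apply: leqW.
Qed.

(** * Finite sums of simple modules *)

Section FiniteSumOfSimples.
Variables (n : nat) (T : 'I_n -> set M).
Hypothesis simT : forall i, simple_submodule (T i).

Definition sum_over (A : {set 'I_n}) : set M :=
  [set y | exists2 t : 'I_n -> M, forall i, T i (t i) & y = \sum_(i in A) t i].

Lemma sum_overP A : submodule (sum_over A).
Proof.
apply/submoduleP; split=> [|a _ _ [t Tt ->] [t' Tt' ->]].
  by exists (fun=> 0); [move=> i; apply: submod0; case: (simT i) | rewrite big1].
exists (fun i => a *: t i + t' i); last by rewrite scaler_sumr big_split.
by move=> i; have [sT _ _] := simT i; apply: submodD => //; apply: submodZ.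
Qed.

(** The least size of such an [A] plays the role of the length of the quotient by [N]. *)
Definition supplement N A : Prop :=
  forall x, exists2 u, N u & sum_over A (x - u).

Lemma supplement_drop N N' A y : submodule N' -> supplement N A -> N `<=` N' ->
  N' y -> sum_over A y -> y <> 0 ->
  exists2 A' : {set 'I_n}, (#|A'| < #|A|)%N & supplement N' A'.
Proof.
move=> sN' supA subN N'y [t Tt yE] yn0.
have [i [iA tin0]] : exists i, i \in A /\ t i <> 0.
  apply: contrapT => no; apply: yn0; rewrite yE big1 // => i iA.
  by apply: contrapT => tin0; apply: no; exists i.
exists (A :\ i)%SET; first by rewrite [X in (_ < X)%N](cardsD1 i) iA.
have sA' := sum_overP (A :\ i)%SET.
move=> x; have [u Nu [s Ts xuE]] := supA x.
have [sTi _ /(_ _ (cyclic_submodP (t i)))] := simT i.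
case=> [_ [a ->]|cyc0|cycT]; first exact: submodZ.
  by case: tin0; have := cyclic_submod_id (t i); rewrite cyc0.
have [a sE] : cyclic_submod (t i) (s i) by rewrite cycT.
exists (u + a *: y); first by apply: submodD; [|apply: subN|apply: submodZ].
rewrite opprD addrA xuE yE (big_setD1 i) //= [X in _ - _ *: X](big_setD1 i) //=.
rewrite scalerDr sE opprD addrACA subrr add0r; apply: submodB => //.
  by exists s.
by apply: submodZ => //; exists t.
Qed.

Lemma supplement_strict N N' A : submodule N -> submodule N' ->
  supplement N A -> N `<=` N' -> ~ N' `<=` N ->
  exists2 A' : {set 'I_n}, (#|A'| < #|A|)%N & supplement N' A'.
Proof.
move=> sN sN' supA subN nsub.
have [x N'x nNx] : exists2 x, N' x & ~ N x.
  apply: contrapT => no; apply: nsub => x N'x.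
  by apply: contrapT => nNx; apply: no; exists x.
have [u Nu Au] := supA x.
apply: (supplement_drop (y := x - u) sN' supA subN _ Au).
  by apply: submodB => //; apply: subN.
by move=> /eqP; rewrite subr_eq0 => /eqP xu; apply: nNx; rewrite xu.
Qed.

Hypothesis sumT : forall x, sum_over [set: 'I_n]%SET x.

Lemma supplement_setT N : submodule N -> supplement N [set: 'I_n]%SET.
Proof. by move=> sN x; exists 0; [exact: submod0 | rewrite subr0]. Qed.

Lemma exists_complement N : submodule N ->
  exists C, [/\ submodule C, forall x, exists2 u, N u & C (x - u) &
                forall y, N y -> C y -> y = 0].
Proof.
move=> sN.
have supT : `[<supplement N [set: 'I_n]%SET>] by apply/asboolP/supplement_setT.
case: (@arg_minnP _ _ (fun A => `[<supplement N A>]) (fun A : {set 'I_n} => #|A|) supT).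
move=> A /asboolP supA minA.
exists (sum_over A); split=> // [|y Ny Ay]; first exact: sum_overP.
apply: contrapT => yn0.
have [A' ltA' supA'] := supplement_drop sN supA (fun _ => id) Ny Ay yn0.
by have := minA A' (introT (asboolP _) supA'); rewrite leqNgt ltA'.
Qed.

(** Each strict inclusion removes at least one index from a supplement, and the first supplement has
    [n] indices. *)
Lemma strict_chain_bound k (N : nat -> set M) :
  (forall i, (i <= k)%N -> submodule (N i)) ->
  (forall i, (i < k)%N -> N i `<=` N i.+1) ->
  (forall i, (i < k)%N -> ~ N i.+1 `<=` N i) -> (k <= n)%N.
Proof.
move=> sN incN strN.
suff [A _] : exists2 A, supplement (N k) A & (#|A| + k <= n)%N.
  by apply: leq_trans; apply: leq_addl.
have : (k <= k)%N by [].
elim: {-2}k => [|i IHi] leik.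
  exists [set: 'I_n]%SET; first by apply: supplement_setT; apply: sN.
  by rewrite cardsT card_ord addn0.
have [A supA leA] := IHi (ltnW leik).
have [A' ltA' supA'] := supplement_strict (sN _ (ltnW leik)) (sN _ leik) supA
  (incN _ leik) (strN _ leik).
by exists A' => //; apply: leq_trans leA; rewrite addnS -addSn leq_add2r.
Qed.

(* The chain stops at a term whose smallest supplement is largest possible. *)
Lemma artinian_of_sum_simples : artinian_module M.
Proof.
move=> N sN decN.
have dec k l : (k <= l)%N -> N l `<=` N k.
  elim: l => [|l IHl]; first by rewrite leqn0 => /eqP ->.
  rewrite leq_eqVlt => /predU1P[-> //|]; rewrite ltnS => /IHl subN.
  exact: subset_trans (decN l) subN.
pose P m := `[<exists k, forall A, supplement (N k) A -> (m <= #|A|)%N>].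
have P0 : exists m, P m by exists 0; apply/asboolP; exists 0.
have Pn m : P m -> (m <= n)%N.
  move=> /asboolP[k /(_ [set: 'I_n]%SET)]; rewrite cardsT card_ord; apply.
  exact: supplement_setT.
have [m /asboolP[k mink] maxm] := ex_maxnP P0 Pn.
exists k => l lekl; apply/seteqP; split; first exact: dec.
apply: contrapT => nsub.
suff : P m.+1 by move/maxm; rewrite ltnn.
apply/asboolP; exists l => A supA.
have [A' ltA' /mink leA'] := supplement_strict (sN l) (sN k) supA (dec _ _ lekl) nsub.
exact: leq_ltn_trans leA' ltA'.
Qed.

End FiniteSumOfSimples.

End Submodules.

(** * The elements [a i] *)

Section ChainElement.
Variables (T : pzRingType) (e : nat -> T) (k : nat) (P : nat -> set T^o).
Hypothesis sP : forall i, (i < k)%N -> submodule (P i).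
Hypothesis Pe1 : forall i, (i < k)%N -> P i (1 - e i).
Hypothesis Pe0 : forall i j, (i < j < k)%N -> P j (e i).

(* The [P i] are left ideals; right ideals are covered by taking [T = R^c]. *)
Fixpoint chain_elt i : T :=
  if i is i'.+1 then chain_elt i' - chain_elt i' * (e i' * chain_elt i') else 1.

Local Notation a := chain_elt.

Let PZ i b (x : T) : (i < k)%N -> P i x -> P i (b * x).
Proof. by move=> ltik; apply: (submodZ b (sP ltik)). Qed.

Let PB i (x y : T) : (i < k)%N -> P i x -> P i y -> P i (x - y).
Proof. by move=> ltik; apply: submodB (sP ltik). Qed.

Let PD i (x y : T) : (i < k)%N -> P i x -> P i y -> P i (x + y).
Proof. by move=> ltik; apply: submodD (sP ltik). Qed.

(** By induction: [1 - a i.+1] is [(1 - a i) + a i * (e i * a i)], and [e i * a i] differs from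
    [e i], a member of [P j], by a left multiple of [1 - a i]. *)
Lemma chain_elt_eq1 i j : (i <= j)%N -> (j < k)%N -> P j (1 - a i).
Proof.
elim: i => [|i IHi] leij ltjk; first by rewrite subrr; apply: submod0 (sP ltjk).
have IH := IHi (ltnW leij) ltjk.
rewrite [a i.+1]/= opprB addrA addrAC -[X in _ + X]opprK; apply: PB => //.
rewrite -mulrN; apply: PZ => //.
have -> : - (e i * a i) = e i * (1 - a i) - e i by rewrite mulrBr mulr1 addrAC subrr add0r.
by apply: PB => //; [apply: PZ | apply: Pe0; rewrite leij].
Qed.

Lemma chain_elt_diag i : (i < k)%N -> P i (1 - e i * a i).
Proof.
move=> ltik; have -> : 1 - e i * a i = 1 - e i + e i * (1 - a i).
  by rewrite mulrBr mulr1 addrA subrK.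
by apply: PD; [|exact: Pe1|apply/PZ/chain_elt_eq1].
Qed.

Lemma chain_elt_mem i j : (j < i)%N -> (j < k)%N -> P j (a i).
Proof.
move=> ltji ltjk; elim: i ltji => [//|i IHi]; rewrite ltnS leq_eqVlt.
case/predU1P=> [<-|/IHi Pai] /=; last by apply: PB => //; do 2![apply: PZ => //].
(* Here [a j.+1] is factored as [a j * (1 - e j * a j)]. *)
by rewrite -[X in X - _]mulr1 -mulrBr; apply/PZ/chain_elt_diag.
Qed.

(** With [chain_elt_diag], this makes the [e i * a i] a Chinese remainder system: 1 modulo [P i] and
    0 modulo every other [P j], although the [e i] are only triangular. *)
Lemma chain_elt_offdiag i j : (i < k)%N -> (j < k)%N -> i != j -> P j (e i * a i).
Proof.
move=> ltik ltjk; rewrite neq_ltn => /orP[ltij|ltji]; last exact/PZ/chain_elt_mem.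
have -> : e i * a i = e i - e i * (1 - a i) by rewrite mulrBr mulr1 opprB addrC subrK.
apply: PB => //; first by apply: Pe0; rewrite ltij.
by apply: PZ => //; apply: chain_elt_eq1 => //; apply: ltnW.
Qed.

End ChainElement.

(** * Right ideals and F-injectivity *)

Section RightIdeals.
Variable R : pzRingType.
Implicit Types (N : set (right_regular R)) (x y c r s : R).

Lemma right_idealM N x r : submodule N -> N x -> N (x * r).
Proof. exact: (@submodZ _ (right_regular R) N r x). Qed.

Lemma right_ideal_setT N : submodule N -> N (1 : R) -> N = setT.
Proof.
move=> sN N1; apply/seteqP; split=> // x _.
by rewrite -[x](mul1r (x : R)); apply: right_idealM.
Qed.

Lemma principal_right_idealP x :
  submodule ([set y | exists r, y = x * r] : set (right_regular R)).
Proof. exact: cyclic_submodP (x : right_regular R). Qed.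

Lemma right_annihilatorP c :
  submodule ([set x | c * (x : R) = 0] : set (right_regular R)).
Proof.
apply/submoduleP; split=> [|b x y cx cy] /=; first by rewrite mulr0.
by rewrite right_regular_scaleE mulrDr mulrA cx cy mul0r addr0.
Qed.

Lemma maximal_proper N : maximal_submodule N -> ~ N (1 : R).
Proof. by case=> sN NnT _ /(right_ideal_setT sN). Qed.

Lemma maximal_comax N x : maximal_submodule N -> ~ N x ->
  exists r, N (1 - x * r).
Proof.
move=> maxN nNx; have [sN _ maxN'] := maxN.
pose L : set (right_regular R) := [set y | exists r, N ((y : R) - x * r)].
have sL : submodule L.
  apply/submoduleP; split=> [|b y z [r Ny] [s Nz]].
    by exists 0; rewrite mulr0 subr0; apply: submod0 sN.
  exists (r * (b : R) + s); rewrite right_regular_scaleE mulrDr mulrA.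
  rewrite opprD addrACA -mulrBl.
  exact: (submodD sN (right_idealM b sN Ny) Nz).
have NL : N `<=` L by move=> y Ny; exists 0; rewrite mulr0 subr0.
have [LN|LT] := maxN' L sL NL; last by have : L (1 : R) by rewrite LT.
by case: nNx; rewrite -LN; exists 1; rewrite mulr1 subrr; apply: submod0 sN.
Qed.

Lemma not_jacobson x : ~ jacobson x ->
  exists2 N : set (right_regular R), maximal_submodule N & ~ N x.
Proof.
move=> nJx; apply: contrapT => no; apply: nJx => N maxN.
by apply: contrapT => nNx; apply: no; exists N.
Qed.

Lemma exists_maximal N : submodule N -> ~ N (1 : R) ->
  exists2 L : set (right_regular R), maximal_submodule L & N `<=` L.
Proof.
move=> sN nN1.
pose P (A : set (right_regular R)) :=
  A = set0 \/ [/\ submodule A, N `<=` A & ~ A (1 : R)].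
have [F PF totF|A [PA maxA]] := @Zorn_bigcup _ P.
  have [[A FA [sA NA nA1]]|no] := pselect (exists2 A, F A &
      [/\ submodule A, N `<=` A & ~ A (1 : R)]); last first.
    left; apply/seteqP; split=> // x [A FA Ax]; case: (PF _ FA) => [A0|PA].
      by rewrite -A0.
    by case: no; exists A.
  have submodF B x : F B -> B x -> submodule B.
    by move=> FB Bx; case: (PF _ FB) => [B0|[]//]; move: Bx; rewrite B0.
  right; split=> [|x Nx|[B FB B1]]; last 2 first.
  - by exists A => //; apply: NA.
  - by case: (PF _ FB) => [B0|[_ _]]; [move: B1; rewrite B0 | apply].
  apply/submoduleP; split=> [|b x y [B FB Bx] [C FC Cy]].
    by exists A => //; apply: submod0.
  have [BC|CB] := totF _ _ FB FC.
    have sC := submodF _ _ FC Cy.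
    by exists C => //; apply: submodD => //; apply: submodZ => //; apply: BC.
  have sB := submodF _ _ FB Bx.
  by exists B => //; apply: submodD => //; [apply: submodZ | apply: CB].
have [sA NA nA1] : [/\ submodule A, N `<=` A & ~ A (1 : R)].
  case: PA => // A0; exfalso; apply: (maxA N); last by right; split.
  by split=> [x|NA]; [rewrite A0 | have := NA _ (submod0 sN); rewrite A0].
exists A => //; split=> // [AT|L sL AL]; first by apply: nA1; rewrite AT.
have [L1|nL1] := pselect (L (1 : R)); first by right; apply: right_ideal_setT.
left; apply: contrapT => LA; apply: (maxA L).
  by split=> // LA'; apply: LA; apply/seteqP.
by right; split=> //; apply: subset_trans AL.
Qed.

Lemma jacobson_right_unit x : jacobson x -> exists s, (1 - x) * s = 1.
Proof.
move=> Jx; apply: contrapT => no.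
have [[s sE]|N maxN subN] := exists_maximal (principal_right_idealP (1 - x)).
  by apply: no; exists s.
have [sN _ _] := maxN; apply: (maximal_proper maxN).
rewrite -[1](subrK x); apply: (submodD sN); last exact: Jx.
by apply: subN; exists 1; rewrite mulr1.
Qed.

(* A right inverse of [1 - x] has the form [1 + x s], so it has a right inverse
   too, which is then [1 - x]. *)
Lemma jacobson_left_unit x : jacobson x -> exists s, s * (1 - x) = 1.
Proof.
move=> Jx; have [s sE] := jacobson_right_unit Jx.
have [|t tE] := @jacobson_right_unit (- (x * s)).
  apply/jacobson_predP; rewrite rpredN; apply: jacobsonMr; exact/jacobson_predP.
have sE' : 1 - - (x * s) = s by rewrite opprK -{1}sE mulrBl mul1r subrK.
exists s; rewrite sE' in tE.
suff -> : 1 - x = t by [].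
by transitivity ((1 - x) * s * t); [rewrite -mulrA tE mulr1 | rewrite sE mul1r].
Qed.

(** The hypothesis makes the map sending [x i] to [y i] well defined on the right ideal generated by
    the [x i]. Its extension [g] to [R] is left multiplication by [g 1]. *)
Lemma Finj_transport n (x y : 'I_n -> R) : right_F_injective R ->
  (forall c : 'I_n -> R, \sum_i x i * c i = 0 -> \sum_i y i * c i = 0) ->
  exists e, forall i, e * x i = y i.
Proof.
move=> hR xy.
pose I : set (right_regular R) := [set z | exists c : 'I_n -> R, z = \sum_i x i * c i].
pose f z := if pselect (I z) is left h then \sum_i y i * sval (cid h) i else 0 : R.
have fE (c : 'I_n -> R) : f (\sum_i x i * c i) = \sum_i y i * c i.
  rewrite /f; case: pselect => [h|[]]; last by exists c.
  case: cid => d /= dE; apply/eqP; rewrite -subr_eq0 -sumrB; apply/eqP.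
  under eq_bigr do rewrite -mulrBr.
  by apply: xy; under eq_bigr do rewrite mulrBr; rewrite sumrB dE subrr.
have linE (z : 'I_n -> R) (b : R) (c d : 'I_n -> R) :
    (\sum_i z i * c i) * b + \sum_i z i * d i
    = \sum_i z i * (c i * b + d i).
  by rewrite mulr_suml -big_split; apply: eq_bigr => i _; rewrite mulrDr mulrA.
have [||b _ _ [c ->] [d ->]|g gE] := hR I f.
- exact: span_eltsP (x : 'I_n -> right_regular R).
- by exists n, x.
- by rewrite !right_regular_scaleE linE !fE linE.
exists (g (1 : R)) => i.
have xE : x i = \sum_j x j * (j == i)%:R.
  rewrite (bigD1 i) //= eqxx mulr1 big1 ?addr0 // => j /negPf ->.
  by rewrite mulr0.
have := linearZ_LR g (x i : R^c) (1 : R); rewrite !right_regular_scaleE mul1r => <-.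
rewrite gE; last by exists (fun j => (j == i)%:R).
rewrite {1}xE fE (bigD1 i) //= eqxx mulr1 big1 ?addr0 // => j /negPf ->.
by rewrite mulr0.
Qed.

End RightIdeals.

(** * Finite dimensional implies semilocal *)

Section FiniteDimensional.
Variables (R : pzRingType) (n : nat).
Hypothesis hR : right_F_injective R.
Hypothesis Gdim_n : Gdim_eq (right_regular R) n.
Implicit Types (x y c r s : R).

(* Injectivity gives [s] with [s c = 1]; if [c s <> 1], the elements
   [c ^+ i * (1 - c * s)] generate an infinite direct sum of right ideals. *)
Lemma right_invertible_of_regular c :
  (forall x, c * x = 0 -> x = 0) -> exists s, c * s = 1.
Proof.
move=> regc.
have [|s /(_ ord0) sc] := @Finj_transport R 1 (fun=> c) (fun=> 1) hR.
  by move=> d; rewrite !big_ord1 mul1r => /regc.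
exists s; apply: contrapT => cs1.
pose K i : set (right_regular R) := [set x | s ^+ i * (x : R) = 0].
have sXcX i : s ^+ i * c ^+ i = 1.
  elim: i => [|i IHi]; first by rewrite !expr0 mulr1.
  by rewrite exprSr exprS mulrA -[_ * s * c]mulrA sc mulr1.
have sd0 : s * (1 - c * s) = 0 by rewrite mulrBr mulr1 mulrA sc mul1r subrr.
have cXK i x : s ^+ i * (c ^+ i * x) = x by rewrite mulrA sXcX mul1r.
have : indep_elts (fun i : 'I_n.+1 => c ^+ i * (1 - c * s) : right_regular R).
  apply: (@chain_indep _ (right_regular R) n.+1 K (fun i => c ^+ i * (1 - c * s)))
    => [i _|i _ x|i _|i b _].
  - exact: right_annihilatorP.
  - by rewrite /K /= exprS -mulrA => ->; rewrite mulr0.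
  - split; first by rewrite /K /= exprS -mulrA cXK.
    move=> z0; apply: cs1; apply/esym/eqP; rewrite -subr_eq0 -[X in X == _](cXK i).
    by rewrite z0 mulr0.
  by rewrite /K /= right_regular_scaleE -mulrA cXK => ->; rewrite mulr0.
by move/(Gdim_bound Gdim_n); rewrite card_ord ltnn.
Qed.

(* With [a i := chain_elt e i], the right annihilators of the [a i] increase
   strictly: [1 - a i * e i] lies in [N i], so it kills some [z <> 0], and then
   [e i * z] is annihilated by [a i.+1] but not by [a i]. *)
Lemma comaximal_bound k (N : nat -> set (right_regular R)) (e : nat -> R) :
  (forall i, (i < k)%N -> maximal_submodule (N i)) ->
  (forall i, (i < k)%N -> N i (1 - e i)) ->
  (forall i j, (i < j < k)%N -> N j (e i)) -> (k <= n)%N.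
Proof.
move=> maxN N1 N0; pose a : nat -> R := @chain_elt R^c e.
have sN i : (i < k)%N -> submodule (N i) by move=> /maxN[].
(* The product is palindromic, so passing to [R^c] changes only its bracketing. *)
have aS i : a i.+1 = a i - a i * e i * a i by [].
have /choice[z zP] : forall i, exists z, (i < k)%N -> z <> 0 /\ e i * a i * z = z.
  move=> i; have [ltik|] := boolP (i < k)%N; last by exists 0.
  have Nae : N i (1 - a i * e i) := @chain_elt_diag R^c e k N sN N1 N0 i ltik.
  have [z [zn0 zE]] : exists z, z <> 0 /\ a i * e i * z = z.
    apply: contrapT => no; have [|s sE] := @right_invertible_of_regular (1 - a i * e i).
      move=> x /eqP; rewrite mulrBl mul1r subr_eq0 => /eqP xE.
      by apply: contrapT => xn0; apply: no; exists x.
    apply: (maximal_proper (maxN _ ltik)); rewrite -sE.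
    exact: right_idealM (sN _ ltik) Nae.
  exists (e i * z) => _; split; last by rewrite -!mulrA [a i * _]mulrA zE.
  by move=> ez0; apply: zn0; rewrite -zE -mulrA ez0 mulr0.
have : indep_elts (fun i : 'I_k => z i : right_regular R).
  pose K i : set (right_regular R) := [set x | a i * (x : R) = 0].
  apply: (@chain_indep _ (right_regular R) k K z) => [i _|i _ x|i ltik|i b ltik].
  - exact: right_annihilatorP.
  - by rewrite /K /mkset aS mulrBl -!mulrA => ->; rewrite !mulr0 subrr.
  - have [zn0 zE] := zP i ltik; split=> //.
    by rewrite /K /mkset aS mulrBl -{1}zE !mulrA subrr.
  rewrite /K /= right_regular_scaleE => az0; have [_ zE] := zP i ltik.
  by rewrite -zE -!mulrA az0 mulr0.
by move/(Gdim_bound Gdim_n); rewrite card_ord.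
Qed.

Lemma jacobson_finite_cap : exists k (N : nat -> set (right_regular R)) (e : nat -> R),
  [/\ forall i, (i < k)%N -> maximal_submodule (N i),
      forall i, (i < k)%N -> N i (1 - e i),
      forall i j, (i < j < k)%N -> N j (e i) &
      forall x : R, (forall i, (i < k)%N -> N i x) -> jacobson x].
Proof.
pose P k := `[<exists (N : nat -> set (right_regular R)) (e : nat -> R),
  [/\ forall i, (i < k)%N -> maximal_submodule (N i),
      forall i, (i < k)%N -> N i (1 - e i) &
      forall i j, (i < j < k)%N -> N j (e i)]>].
have P0 : exists k, P k.
  exists 0; apply/asboolP; exists (fun=> setT), (fun=> 0).
  by split=> // i j; rewrite ltn0 andbF.
have Pn k : P k -> (k <= n)%N.
  by case/asboolP=> N [e [maxN N1 N0]]; apply: comaximal_bound maxN N1 N0.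
have [k /asboolP[N [e [maxN N1 N0]]] maxk] := ex_maxnP P0 Pn.
exists k, N, e; split=> // x Nx; apply: contrapT => /not_jacobson[L maxL nLx].
have [r Lr] := maximal_comax maxL nLx.
suff : P k.+1 by move/maxk; rewrite ltnn.
(* The new ideal goes in front: [x * r] lies in all the former [N j], while the former [e i] need
   satisfy nothing modulo [L]. *)
apply/asboolP; exists (fun i => if i is i'.+1 then N i' else L).
exists (fun i => if i is i'.+1 then e i' else x * r); split=> [[|i]|[|i]|[|i] [|j]] //.
- exact: maxN.
- exact: N1.
- by move=> /= ltjk; apply: right_idealM (Nx _ _) => //; case: (maxN j ltjk).
- exact: N0.
Qed.

End FiniteDimensional.

(** * Chinese remainder decomposition of [R/J(R)] *)

Section SemisimpleQuotient.
Variable R : pzRingType.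
Local Notation pi := (@quotJ_pi R).
Local Notation S := (quotJ R).

Let image (f : R) : set (right_regular S) := cyclic_submod (pi f : right_regular S).

Let imageP (f : R) y : image f y <-> exists r, y = pi (f * r).
Proof.
split=> [[b ->]|[r ->]]; last by exists (pi r); rewrite rmorphM.
by have [r rE] := quotJ_pi_surj b; exists r; rewrite rE right_regular_scaleE rmorphM.
Qed.

(** The [f i] below are 1 modulo [N i] and 0 modulo the other [N j]. Their classes therefore sum to
    1, and each generates a simple right ideal of the quotient. *)
Lemma semilocal_of_finite_cap k (N : nat -> set (right_regular R)) (e : nat -> R) :
  (forall i, (i < k)%N -> maximal_submodule (N i)) ->
  (forall i, (i < k)%N -> N i (1 - e i)) ->
  (forall i j, (i < j < k)%N -> N j (e i)) ->
  (forall x : R, (forall i, (i < k)%N -> N i x) -> jacobson x) ->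
  semilocal R.
Proof.
move=> maxN N1 N0 capN.
have sN i : (i < k)%N -> submodule (N i) by move=> /maxN[].
have piN (x : R) : (forall i, (i < k)%N -> N i x) -> pi x = 0.
  by move=> Nx; apply/quotJ_pi_eq0; exact: (capN x Nx).
pose f i : R := (@chain_elt R^c e i : R) * e i.
have Nf1 i : (i < k)%N -> N i (1 - f i) := @chain_elt_diag R^c e k N sN N1 N0 i.
have Nf0 i j : (i < k)%N -> (j < k)%N -> i != j -> N j (f i) :=
  @chain_elt_offdiag R^c e k N sN N1 N0 i j.
have Nf0M i j r : (i < k)%N -> (j < k)%N -> i != j -> N j (f i * r).
  by move=> ltik ltjk neij; apply: right_idealM; [apply: sN | apply: Nf0].
pose T (i : 'I_k) := image (f i).
have simT i : simple_submodule (T i).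
  split; first exact: cyclic_submodP.
    apply: set_neq0 (cyclic_submod_id _) _ => /quotJ_pi_eq0 Jfi.
    have Nfi := Jfi _ (maxN i (ltn_ord i)).
    apply: (maximal_proper (maxN i (ltn_ord i))).
    by rewrite -[1](subrK (f i)); apply: submodD (sN _ _) (Nf1 _ _) Nfi.
  move=> L sL subL; have [L0|Ln0] := pselect (L = [set 0]); first by left.
  right; apply/seteqP; split=> //.
  have [y Ly yn0] := submod_neq0 sL Ln0; have [r yE] := (imageP _ _).1 (subL y Ly).
  have nNfr : ~ N i (f i * r).
    move=> Nfr; apply: yn0; rewrite yE; apply: piN => j ltjk.
    have [<-//|neij] := eqVneq (i : nat) j; exact: Nf0M.
  have [s Ns] := maximal_comax (maxN i (ltn_ord i)) nNfr.
  have Lf : L (pi (f i)).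
    (* The difference comes from [(1 - f i * r * s) * f i], which lies in [N i] by the choice of
       [s], and in the other [N j] because both of its terms begin with [f i]. *)
    have -> : pi (f i) = (y : S) * pi (s * f i).
      apply/eqP; rewrite -subr_eq0 yE -rmorphM -rmorphB; apply/eqP.
      have -> : f i - f i * r * (s * f i) = (1 - f i * r * s) * f i.
        by rewrite mulrBl mul1r !mulrA.
      apply: piN => j ltjk; have [<-|neij] := eqVneq (i : nat) j.
        exact: right_idealM (sN _ _) Ns.
      rewrite mulrBl mul1r -2!(mulrA (f i)).
      apply: (submodB (sN _ ltjk)); first exact: Nf0.
      exact: Nf0M.
    exact: right_idealM.
  by move=> _ [b ->]; apply: submodZ.
have sum1 : pi 1 = \sum_(i < k) pi (f i).
  rewrite -rmorph_sum; apply/eqP; rewrite -subr_eq0 -rmorphB; apply/eqP.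
  apply: piN => j ltjk; rewrite (bigD1 (Ordinal ltjk)) //= opprD addrA.
  apply: (submodB (sN _ ltjk)); first exact: Nf1.
  apply: (submod_sum (sN _ ltjk)).
  by move=> i; rewrite -val_eqE /= => neij; apply: Nf0.
have sumT (x : right_regular S) : x = \sum_(i < k) (pi (f i) : S) * x.
  by rewrite -mulr_suml -sum1 rmorph1 mul1r.
have Tx i (x : right_regular S) : T i ((pi (f i) : S) * x) by exists x.
split=> [x|].
  exists k, (fun i => (pi (f i) : S) * x); split=> // i.
  by exists (T i).
apply: (artinian_of_sum_simples simT) => x; exists (fun i => (pi (f i) : S) * x) => //.
by rewrite {1}(sumT x); apply: eq_bigl => i; rewrite inE.
Qed.

End SemisimpleQuotient.

(** * Semilocal implies finite dimensional *)

Section SemisimpleRing.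
Variable S : pzRingType.

Lemma semisimple_sum_simples : semisimple_module (right_regular S) ->
  exists n (T : 'I_n -> set (right_regular S)),
    (forall i, simple_submodule (T i)) /\
    forall x, sum_over T [set: 'I_n]%SET x.
Proof.
move=> /(_ (1 : S))[n [y [simy sum1]]].
have /choice[T simT] : forall i, exists N, simple_submodule N /\ N (y i).
  by move=> i; have [N simN Ny] := simy i; exists N.
exists n, T; split=> [i|x]; first exact: (simT i).1.
exists (fun i => x *: y i) => [i|].
  by have [[sT _ _] Ty] := simT i; apply: submodZ.
rewrite -scaler_sumr (eq_bigl xpredT) => [|i]; last by rewrite inE.
by rewrite -sum1 right_regular_scaleE mul1r.
Qed.

(** Split 1 as [a * t + c] along a complement [C] of the right ideal generated by [a]. Then
    [a - a * t * a = c * a] lies in both summands. *)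
Lemma semisimple_von_Neumann_regular (a : S) : semisimple_module (right_regular S) ->
  exists t, a * t * a = a.
Proof.
move=> /semisimple_sum_simples[n [T [simT sumT]]].
have [C [sC compl disj]] := exists_complement simT sumT (principal_right_idealP a).
have [_ [t ->] C1] := compl (1 : S); exists t.
suff : a - a * t * a = 0 by move=> /eqP; rewrite subr_eq0 => /eqP.
apply: disj; last by rewrite -[X in X - _]mul1r -mulrBl; apply: right_idealM sC C1.
by exists (1 - t * a); rewrite mulrBr mulr1 mulrA.
Qed.

End SemisimpleRing.

Section SemilocalBound.
Variable R : pzRingType.
Local Notation pi := (@quotJ_pi R).
Local Notation S := (quotJ R).

Lemma quotJ_pi_eq1 (r : R) : pi r = 1 -> exists s, s * r = 1.
Proof.
move=> r1; have /jacobson_left_unit : jacobson (1 - r).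
  by apply/quotJ_pi_eq0; rewrite rmorphB rmorph1 /= r1 subrr.
by rewrite opprB addrC subrK.
Qed.

(* The left annihilators of the [x j] induce comaximal proper left ideals [P j] of
   [R/J].  With [a i := chain_elt e i] in [R/J], the right annihilators of the [a i]
   increase strictly, since otherwise [a i] would be a left multiple of [a i.+1],
   which lies in [P i]. *)
Lemma semilocal_indep_bound : right_F_injective R -> semilocal R ->
  exists n, forall k (x : 'I_k -> right_regular R), indep_elts x -> (k <= n)%N.
Proof.
move=> hR [ssS _]; have [n [T [simT sumT]]] := semisimple_sum_simples ssS.
exists n => k x [xn0 indx].
have /choice[e eE] : forall i, exists e : R, (i < k)%N ->
    forall j : 'I_k, e * (x j : R) = if j == i :> nat then x j : R else 0.
  move=> i; pose y (j : 'I_k) := if j == i :> nat then x j : R else 0.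
  have [|e eE] := @Finj_transport R k x y hR; last by exists e.
  move=> c /indx xc0; apply: big1 => j _.
  rewrite /y; case: ifP => _; last by rewrite mul0r.
  exact: xc0.
(* The image of the left annihilator of [x i]; for [i >= k] the condition is vacuous and [P i] is
   the whole ring. *)
pose P i : set S^o := [set s | exists r, s = pi r /\
  forall j : 'I_k, j = i :> nat -> r * (x j : R) = 0].
have sP i : submodule (P i).
  apply/submoduleP; split=> [|b _ _ [r [-> rx]] [s [-> sx]]].
    by exists 0; split=> [|j _]; rewrite ?rmorph0 ?mul0r.
  have [b' ->] := quotJ_pi_surj b; exists (b' * r + s).
  split=> [|j ji]; first by rewrite rmorphD rmorphM.
  by rewrite mulrDl -mulrA rx // sx // mulr0 addr0.
have P1 i : (i < k)%N -> P i (1 - pi (e i)).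
  move=> ltik; exists (1 - e i); split=> [|j ji]; first by rewrite rmorphB rmorph1.
  by rewrite mulrBl mul1r eE // ji eqxx subrr.
have P0 i j : (i < j < k)%N -> P j (pi (e i)).
  move=> /andP[ltij ltjk]; exists (e i); split=> // l lj.
  by rewrite eE ?(ltn_trans ltij) // lj gtn_eqF.
pose a := @chain_elt S (pi \o e).
have aS i : a i.+1 = a i - a i * (pi (e i) * a i) by [].
pose K i : set (right_regular S) := [set s | a i * (s : S) = 0].
apply: (@strict_chain_bound _ _ n T simT sumT k K) => [i _|i _ s|i ltik subK].
- exact: right_annihilatorP.
- by rewrite /K /mkset aS mulrBl -!mulrA => ->; rewrite !mulr0 subrr.
(* Regularity puts [1 - t * a i.+1] in [K i.+1], hence in [K i] by the assumed inclusion. *)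
have [t tE] := semisimple_von_Neumann_regular (a i.+1) ssS.
have aE : a i = a i * t * a i.+1.
  have : K i (1 - t * a i.+1).
    by apply: subK; rewrite /K /mkset mulrBr mulr1 mulrA tE subrr.
  by rewrite /K /mkset mulrBr mulr1 mulrA => /eqP; rewrite subr_eq0 => /eqP.
have [r [r1 rx]] : P i (1 : S).
  rewrite -[1](subrK (a i)); apply: (submodD (sP i)).
    exact: (@chain_elt_eq1 S (pi \o e) k P (fun i _ => sP i) P0).
  rewrite aE; apply: (submodZ _ (sP i)).
  exact: (@chain_elt_mem S (pi \o e) k P (fun i _ => sP i) P1 P0).
(* Being 1 modulo the radical, [r] is left invertible; as it kills [x i], this forces [x i = 0]. *)
have [s sr1] := quotJ_pi_eq1 (esym r1).
apply: (xn0 (Ordinal ltik)).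
by rewrite -[LHS](mul1r (x _ : R)) -sr1 -mulrA rx // mulr0.
Qed.

End SemilocalBound.

Theorem theorem3p4 (R : pzRingType) (hR : right_F_injective R) :
  semilocal R <-> right_finite_dimensional R.
Proof.
split=> [/(semilocal_indep_bound hR)[n]|[n Gdim_n]].
  exact: Gdim_finite_of_bound.
have [k [N [e [maxN N1 N0 capN]]]] := jacobson_finite_cap hR Gdim_n.
exact: semilocal_of_finite_cap maxN N1 N0 capN.
Qed.
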